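(* Let $(\mathcal{M},c,\mathcal{A})$ be an $A_2$-triple with operations $\mu,m_L,m_R,\tau_L,\tau_R,\sigma,\beta$. Then the formula $$m\big((a,\bar x),(a',\bar x')\big)=\Big(\mu(a,a')+(-1)^{|a|}\tau_R(a,x')+\tau_L(x,a')-(-1)^{|\bar x|}\beta(x,x'),\;(-1)^{|a|}\overline{m_L(a,x')}+\overline{m_R(x,a')}-(-1)^{|\bar x|}\overline{\sigma(x,x')}\Big)$$ defines a degree $0$ bilinear product $m:Cone(c)\otimes Cone(c)\to Cone(c)$ which is a chain map and thus descends to homology. This product is functorial with respect to homotopy retracts and morphisms of $A_2$-triples, in the following sense. (i) If a triple $(\mathcal{M}',c',\mathcal{A}')$ (chain complexes and a degree $0$ chain map $c':\mathcal{M}'\to\mathcal{A}'$) is a homotopy retract of the triple $(\mathcal{M},c,\mathcal{A})$ with maps $P:Cone(c)\to Cone(c')$ and $I:Cone(c')\to Cone(c)$, then there is an induced structure of an $A_2$-triple on $(\mathcal{M}',c',\mathcal{A}')$ such that $P$ and $I$ are compatible, up to chain homotopy, with the products on $Cone(c)$ and $Cone(c')$. (ii) A special morphism of $A_2$-triples $(g,f):(\mathcal{M},c,\mathcal{A})\to(\mathcal{M}',c',\mathcal{A}')$ induces a degree $0$ chain map $Cone(g,f):Cone(c)\to Cone(c')$, $(a,\bar x)\mapsto (f(a),\overline{g(x)})$, which intertwines the products on $Cone(c)$ and $Cone(c')$ up to chain homotopy.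
   Context: Coefficients are in a principal ideal domain $R$; chain complexes are $\mathbb{Z}$-graded with differential $\partial$ of degree $-1$; $V[k]_i=V_{i+k}$, $\partial_{V[k]}=(-1)^k\partial_V$. The Koszul sign rule is used, and $[\partial,\phi]=\partial\phi-(-1)^{|\phi|}\phi\partial$, where $\partial$ on a tensor product is $\partial\otimes 1+1\otimes\partial$. Cone: for a degree $0$ chain map $c:\mathcal{M}\to\mathcal{A}$, $Cone(c)=\mathcal{A}\oplus\mathcal{M}[-1]$. An element is written $(a,\bar x)$, where $\bar x\in\mathcal{M}[-1]$ is the shift of $x\in\mathcal{M}$, so $|\bar x|=|x|+1$. The differential is $\partial(a,\bar x)=(\partial_{\mathcal{A}}a+c(x),-\overline{\partial_{\mathcal{M}}x})$. $A_2$-triple: $(\mathcal{M},c,\mathcal{A})$ consists of an associative-up-to-homotopy dg algebra $(\mathcal{A},\mu)$, a chain complex $\mathcal{M}$, a degree $0$ chain map $c:\mathcal{M}\to\mathcal{A}$, and bilinear maps $m_L:\mathcal{A}\otimes\mathcal{M}\to\mathcal{M}$, $m_R:\mathcal{M}\otimes\mathcal{A}\to\mathcal{M}$ of degree $0$; $\tau_L:\mathcal{M}\otimes\mathcal{A}\to\mathcal{A}$, $\tau_R:\mathcal{A}\otimes\mathcal{M}\to\mathcal{A}$, $\sigma:\mathcal{M}\otimes\mathcal{M}\to\mathcal{M}$ of degree $1$; $\beta:\mathcal{M}\otimes\mathcal{M}\to\mathcal{A}$ of degree $2$, such that $[\partial,\mu]=[\partial,m_L]=[\partial,m_R]=0$,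 $[\partial,\tau_L]=\mu(c\otimes 1)-c\,m_R$, $[\partial,\tau_R]=\mu(1\otimes c)-c\,m_L$, $[\partial,\sigma]=m_R(1\otimes c)-m_L(c\otimes 1)$, $[\partial,\beta]=-c\sigma+\tau_R(c\otimes 1)-\tau_L(1\otimes c)$. Homotopy retract: $(\mathcal{M}',c',\mathcal{A}')$ is a homotopy retract of $(\mathcal{M},c,\mathcal{A})$ if there are degree $0$ chain maps $P:Cone(c)\to Cone(c')$, $I:Cone(c')\to Cone(c)$ and a degree $1$ map $H:Cone(c)\to Cone(c)$, all upper triangular with respect to the splittings $Cone(c)=\mathcal{A}\oplus\mathcal{M}[-1]$ and $Cone(c')=\mathcal{A}'\oplus\mathcal{M}'[-1]$ (i.e. mapping the $\mathcal{A}$-type summand into the $\mathcal{A}$-type summand), with $[\partial,H]=1-IP$. Special morphism of $A_2$-triples $(g,f):(\mathcal{M},c,\mathcal{A})\to(\mathcal{M}',c',\mathcal{A}')$ (operations of the target carry primes): (1) degree $0$ chain maps $g:\mathcal{M}\to\mathcal{M}'$, $f:\mathcal{A}\to\mathcal{A}'$ with $fc=c'g$; (2) degree $1$ bilinear maps $\hat\mu:\mathcal{A}\otimes\mathcal{A}\to\mathcal{A}'$, $\hat m_L:\mathcal{A}\otimes\mathcal{M}\to\mathcal{M}'$, $\hat m_R:\mathcal{M}\otimes\mathcal{A}\to\mathcal{M}'$ with $[\partial,\hat\mu]=\mu'(f\otimes f)-f\mu$, $[\partial,\hat m_L]=m_L'(f\otimes g)-g m_L$, $[\partial,\hat m_R]=m_R'(g\otimes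 f)-g m_R$; (3) degree $2$ bilinear maps $\hat\sigma:\mathcal{M}\otimes\mathcal{M}\to\mathcal{M}'$, $\hat\tau_L:\mathcal{M}\otimes\mathcal{A}\to\mathcal{A}'$, $\hat\tau_R:\mathcal{A}\otimes\mathcal{M}\to\mathcal{A}'$ with $[\partial,\hat\sigma]=\sigma'(g\otimes g)-g\sigma-\hat m_R(1\otimes c)+\hat m_L(c\otimes 1)$, $[\partial,\hat\tau_L]=\tau_L'(g\otimes f)-f\tau_L-\hat\mu(c\otimes 1)+c'\hat m_R$, $[\partial,\hat\tau_R]=\tau_R'(f\otimes g)-f\tau_R-\hat\mu(1\otimes c)+c'\hat m_L$; (4) a degree $3$ bilinear map $\hat\beta:\mathcal{M}\otimes\mathcal{M}\to\mathcal{A}'$ with $[\partial,\hat\beta]=\beta'(g\otimes g)-f\beta+c'\hat\sigma-\hat\tau_R(c\otimes 1)+\hat\tau_L(1\otimes c)$. *)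

(* Defs.v *)
(* [boolp] only serves to make "is a boundary" a boolean predicate, so that
   homology can be formed with [ring_quotient]. *)
From HB Require Import structures.
From mathcomp Require Import all_boot all_order all_algebra.
From mathcomp Require Import sesquilinear generic_quotient ring_quotient boolp.

Set Implicit Arguments.
Unset Strict Implicit.
Unset Printing Implicit Defensive.

Import GRing.Theory.
Local Open Scope ring_scope.

Definition principal_ideal_domain (R : idomainType) : Prop :=
  forall J : R -> Prop,
    J 0 -> (forall x y, J x -> J y -> J (x + y)) ->
    (forall r x, J x -> J (r * x)) ->
  exists a, forall x, J x <-> exists r, x = r * a.

(* Graded modules are families [V : int -> lmodType R].  A map of degree k is
   a family of components indexed by source AND target degrees, whose
   components off the line (target = source + k) vanish.  This spares all
   transports along equations between degrees such as (i + k) + l = i + (k + l):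
   an identity between elements of degree l is written with components that
   land in degree l on the nose. *)

Section Graded.
Variable R : idomainType.
Implicit Types (k : int) (U V W X : int -> lmodType R).

Record gmap k V W := Gmap {
  gmap_fun :> forall i j, {linear V i -> W j};
  gmap_deg : forall i j x, j != i + k -> gmap_fun i j x = 0 }.

Record gbimap k U V W := Gbimap {
  gbimap_fun :> forall i j l, {bilinear U i -> V j -> W l};
  gbimap_deg : forall i j l u v, l != i + j + k -> gbimap_fun i j l u v = 0 }.

Record trilinear (U V W X : lmodType R) := Trilinear {
  trilinear_fun :> U -> V -> W -> X;
  trilinear1 : forall v w, linear (fun u => trilinear_fun u v w);
  trilinear2 : forall u w, linear (fun v => trilinear_fun u v w);
  trilinear3 : forall u v, linear (fun w => trilinear_fun u v w) }.

Record gtrimap k U V W X := Gtrimap {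
  gtrimap_fun :> forall i j l n, trilinear (U i) (V j) (W l) (X n);
  gtrimap_deg : forall i j l n u v w,
    n != i + j + l + k -> gtrimap_fun i j l n u v w = 0 }.

Record chain_complex := ChainComplex {
  cc_obj :> int -> lmodType R;
  diff : gmap (-1) cc_obj cc_obj;
  diff_diff : forall i j l x, diff j l (diff i j x) = 0 }.

Definition sgn (i : int) : R := (-1) ^ i.

End Graded.

(* The commutators [d, f] = d f - (-1)^k f d of maps of degree k with the
   differentials; the last index of the commutator is the target degree, and on tensor products
   d (u (x) v) = du (x) v + (-1)^|u| u (x) dv. *)
Section Commutators.
Variable R : idomainType.
Implicit Types (k : int) (C D E F : chain_complex R).

Definition dmap k C D (f : gmap k C D) i l (x : C i) : D l :=
  diff D (i + k) l (f i (i + k) x)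
  - sgn R k *: f (i - 1) l (diff C i (i - 1) x).
Arguments dmap {k C D} f i l x.

Definition dbimap k C D E (f : gbimap k C D E) i j l (x : C i) (y : D j) : E l :=
  diff E (i + j + k) l (f i j (i + j + k) x y)
  - sgn R k *: (f (i - 1) j l (diff C i (i - 1) x) y
                + sgn R i *: f i (j - 1) l x (diff D j (j - 1) y)).
Arguments dbimap {k C D E} f i j l x y.

Definition dtrimap k C D E F (f : gtrimap k C D E F) i j l n
    (x : C i) (y : D j) (z : E l) : F n :=
  diff F (i + j + l + k) n (f i j l (i + j + l + k) x y z)
  - sgn R k *: (f (i - 1) j l n (diff C i (i - 1) x) y z
                + sgn R i *: f i (j - 1) l n x (diff D j (j - 1) y) z
                + sgn R (i + j) *: f i j (l - 1) n x y (diff E l (l - 1) z)).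
Arguments dtrimap {k C D E F} f i j l n x y z.

Definition chain_map C D (f : gmap 0 C D) : Prop :=
  forall i l x, dmap f i l x = 0.

Definition bilinear_chain_map k C D E (m : gbimap k C D E) : Prop :=
  forall i j l x y, dbimap m i j l x y = 0.

(* F m - m' (F (x) F) = [d, K] for some bilinear K of degree 1. *)
Definition intertwines_up_to_homotopy C D
    (F : gmap 0 C D) (m : gbimap 0 C C C) (m' : gbimap 0 D D D) : Prop :=
  exists K : gbimap 1 C C D, forall i j l (x : C i) (y : C j),
    dbimap K i j l x y = F (i + j) l (m i j (i + j) x y) - m' i j l (F i i x) (F j j y).

Definition homotopy_associative C (mu : gbimap 0 C C C) : Prop :=
  exists h : gtrimap 1 C C C C, forall i j l n (a : C i) (b : C j) (c : C l),
    dtrimap h i j l n a b c =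
      mu (i + j) l n (mu i j (i + j) a b) c - mu i (j + l) n a (mu j l (j + l) b c).

End Commutators.
Arguments dmap {R k C D} f i l x.
Arguments dbimap {R k C D E} f i j l x y.
Arguments dtrimap {R k C D E F} f i j l n x y z.

Section Homology.
Variables (R : idomainType) (C : chain_complex R) (n : int).

Definition cycle_pred : {pred C n} := fun x => diff C n (n - 1) x == 0.

Fact cycle_submod : submod_closed cycle_pred.
Proof.
split=> [|a x y /eqP dx /eqP dy]; first by apply/eqP; rewrite linear0.
by apply/eqP; rewrite linearP dx dy scaler0 addr0.
Qed.
HB.instance Definition _ :=
  GRing.isSubmodClosed.Build R (C n) cycle_pred cycle_submod.

Record cycles := Cycle { cycle_val :> C n; _ : cycle_val \in cycle_pred }.
HB.instance Definition _ := [isSub for cycle_val].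
HB.instance Definition _ := [Choice of cycles by <:].
HB.instance Definition _ := [SubChoice_isSubLmodule of cycles by <:].

Definition boundary_pred : {pred cycles} :=
  fun z => `[< exists y : C (n + 1), diff C (n + 1) n y = cycle_val z >].

Fact boundary_submod : submod_closed boundary_pred.
Proof.
split=> [|a x y /asboolP[u du] /asboolP[v dv]]; apply/asboolP.
  by exists 0; rewrite linear0.
by exists (a *: u + v); rewrite linearP du dv.
Qed.
HB.instance Definition _ :=
  GRing.isSubmodClosed.Build R cycles boundary_pred boundary_submod.

Definition homology := Quotient.quot boundary_pred.
HB.instance Definition _ := GRing.Zmodule.on homology.

Definition hclass (z : cycles) : homology := \pi_(Quotient.quot boundary_pred)%qT z.

Definition hscale (a : R) (x : homology) : homology :=
  hclass (a *: repr (x : Quotient.quot boundary_pred)).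

Lemma hclass_eq (z w : cycles) :
  (hclass z = hclass w) <-> exists y : C (n + 1), diff C (n + 1) n y = z - w :> C n.
Proof.
split=> [/eqP|zw]; last apply/eqP; rewrite -Quotient.idealrBE.
  by move/asboolP=> [y dy]; exists y; rewrite dy.
by apply/asboolP; case: zw => y dy; exists y; rewrite dy.
Qed.

Lemma hclass_repr (x : homology) : hclass (repr (x : Quotient.quot boundary_pred)) = x.
Proof. exact: reprK. Qed.

Lemma hclassD z w : hclass (z + w) = hclass z + hclass w.
Proof. exact: Quotient.pi_add. Qed.

Lemma hclassZ a z : hclass (a *: z) = hscale a (hclass z).
Proof.
apply/hclass_eq.
have /hclass_eq[y dy] := esym (hclass_repr (hclass z)).
by exists (a *: y); rewrite linearZ /= dy scalerBr.
Qed.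

Fact hscaleA a b x : hscale a (hscale b x) = hscale (a * b) x.
Proof. by rewrite -[x]hclass_repr -!hclassZ scalerA. Qed.
Fact hscale1 : left_id 1 hscale.
Proof. by move=> x; rewrite -[x]hclass_repr -hclassZ scale1r. Qed.
Fact hscaleDr : right_distributive hscale +%R.
Proof.
move=> a x y; rewrite -[x]hclass_repr -[y]hclass_repr.
by rewrite -hclassD -!hclassZ scalerDr hclassD.
Qed.
Fact hscaleDl x : {morph hscale^~ x : a b / a + b}.
Proof. by move=> a b; rewrite -[x]hclass_repr -!hclassZ scalerDl hclassD. Qed.
HB.instance Definition _ := GRing.Zmodule_isLmodule.Build R homology
  hscaleA hscale1 hscaleDr hscaleDl.

End Homology.

Definition descends_to_homology (R : idomainType) (C : chain_complex R)
    (m : gbimap 0 C C C) : Prop :=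
  forall i j, exists hm : {bilinear homology C i -> homology C j -> homology C (i + j)},
    forall (z : cycles C i) (z' : cycles C j),
      exists2 w : cycles C (i + j),
        w = m i j (i + j) z z' :> C (i + j) & hm (hclass z) (hclass z') = hclass w.

Section Triples.
Variable R : idomainType.

Record triple := Triple {
  tM : chain_complex R;
  tA : chain_complex R;
  tc : gmap 0 tM tA;
  tc_chain : chain_map tc }.

Fact pair_eq (S T : Type) (p q : S * T) : p.1 = q.1 -> p.2 = q.2 -> p = q.
Proof. by case: p q => [? ?] [? ?] /= -> ->. Qed.

Section Cone.
Variable t : triple.
Local Notation M := (tM t).
Local Notation A := (tA t).
Local Notation c := (tc t).

(* An element of degree i is a pair (a, xbar) with |a| = i and |x| = i - 1. *)
Definition cone_obj (i : int) : lmodType R := (A i * M (i - 1))%type.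

Definition cone_diff_fun i j (z : cone_obj i) : cone_obj j :=
  (diff A i j z.1 + c (i - 1) j z.2, - diff M (i - 1) (j - 1) z.2).

Fact cone_diff_linear i j : linear (@cone_diff_fun i j).
Proof.
move=> a z w; apply: pair_eq => /=; first by rewrite !linearP /= scalerDr addrACA.
by rewrite linearP /= opprD scalerN.
Qed.
HB.instance Definition _ i j := GRing.isLinear.Build R (cone_obj i) (cone_obj j) _
  (@cone_diff_fun i j) (@cone_diff_linear i j).

Fact cone_diff_deg i j (z : cone_obj i) : j != i + (-1) -> cone_diff_fun j z = 0.
Proof.
move=> ij; apply: pair_eq => /=.
  by rewrite !gmap_deg ?addr0.
by rewrite gmap_deg ?oppr0 // (inj_eq (addIr _)).
Qed.

Definition cone_diff : gmap (-1) cone_obj cone_obj :=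
  @Gmap R (-1) cone_obj cone_obj (fun i j => @cone_diff_fun i j) cone_diff_deg.

Fact cone_diff_diff i j l z : cone_diff j l (cone_diff i j z) = 0.
Proof.
apply: pair_eq => /=; last by rewrite linearN diff_diff !oppr0.
rewrite linearD linearN diff_diff add0r.
have [->|ij] := eqVneq j (i - 1); last first.
  rewrite (gmap_deg c) ?addr0 // linear0 sub0r.
  by rewrite (gmap_deg (diff M)) ?linear0 ?oppr0 // (inj_eq (addIr _)).
have := @tc_chain t (i - 1) l z.2.
by rewrite /dmap addr0 /sgn expr0z scale1r.
Qed.

Definition Cone : chain_complex R := ChainComplex cone_diff_diff.

End Cone.

Record A2_structure (t : triple) := A2Structure {
  a2_mu : gbimap 0 (tA t) (tA t) (tA t);
  a2_mL : gbimap 0 (tA t) (tM t) (tM t);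
  a2_mR : gbimap 0 (tM t) (tA t) (tM t);
  a2_tauL : gbimap 1 (tM t) (tA t) (tA t);
  a2_tauR : gbimap 1 (tA t) (tM t) (tA t);
  a2_sigma : gbimap 1 (tM t) (tM t) (tM t);
  a2_beta : gbimap 2 (tM t) (tM t) (tA t);
  a2_mu_assoc : homotopy_associative a2_mu;
  a2_mu_chain : bilinear_chain_map a2_mu;
  a2_mL_chain : bilinear_chain_map a2_mL;
  a2_mR_chain : bilinear_chain_map a2_mR;
  a2_tauLP : forall i j l (x : tM t i) (a : tA t j),
    dbimap a2_tauL i j l x a =
      a2_mu i j l (tc t i i x) a - tc t (i + j) l (a2_mR i j (i + j) x a);
  a2_tauRP : forall i j l (a : tA t i) (x : tM t j),
    dbimap a2_tauR i j l a x =
      a2_mu i j l a (tc t j j x) - tc t (i + j) l (a2_mL i j (i + j) a x);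
  a2_sigmaP : forall i j l (x : tM t i) (y : tM t j),
    dbimap a2_sigma i j l x y =
      a2_mR i j l x (tc t j j y) - a2_mL i j l (tc t i i x) y;
  a2_betaP : forall i j l (x : tM t i) (y : tM t j),
    dbimap a2_beta i j l x y =
      - tc t (i + j + 1) l (a2_sigma i j (i + j + 1) x y)
      + a2_tauR i j l (tc t i i x) y - a2_tauL i j l x (tc t j j y) }.

Section ConeProduct.
Variables (t : triple) (S : A2_structure t).

(* z = (a, xbar) and w = (a', xbar') have degrees i and j. *)
Definition cone_mul_fun i j l (z : Cone t i) (w : Cone t j) : Cone t l :=
  let a := z.1 in let x := z.2 in let a' := w.1 in let x' := w.2 in
  (  a2_mu S i j l a a'
     + sgn R i *: a2_tauR S i (j - 1) l a x'
     + a2_tauL S (i - 1) j l x a'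
     - sgn R i *: a2_beta S (i - 1) (j - 1) l x x',
     sgn R i *: a2_mL S i (j - 1) (l - 1) a x'
     + a2_mR S (i - 1) j (l - 1) x a'
     - sgn R i *: a2_sigma S (i - 1) (j - 1) (l - 1) x x').

Fact comb_linear (V : lmodType R) (e b : R) (p1 q1 p2 q2 p3 q3 : V) :
  e *: (b *: p1 + q1) + (b *: p2 + q2) - e *: (b *: p3 + q3) =
  b *: (e *: p1 + p2 - e *: p3) + (e *: q1 + q2 - e *: q3).
Proof.
rewrite !scalerDr !scalerN !(scalerA b e) (mulrC b e) -!scalerA opprD.
by rewrite [X in X + _ = _]addrACA [LHS]addrACA.
Qed.

Fact comb_linear0 (V : lmodType R) (e b : R) (p0 q0 p1 q1 p2 q2 p3 q3 : V) :
  b *: p0 + q0 + e *: (b *: p1 + q1) + (b *: p2 + q2) - e *: (b *: p3 + q3) =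
  b *: (p0 + e *: p1 + p2 - e *: p3) + (q0 + e *: q1 + q2 - e *: q3).
Proof.
have assoc (x0 x1 x2 x3 : V) : x0 + x1 + x2 - x3 = x0 + (x1 + x2 - x3).
  by rewrite !addrA.
by rewrite !assoc comb_linear [b *: (p0 + _)]scalerDr [LHS]addrACA.
Qed.

Fact cone_mul_bilinear i j l : bilinear_for *:%R *:%R (@cone_mul_fun i j l).
Proof.
by split=> [w|z] b u v; apply: pair_eq;
  rewrite /= ?linearPl ?linearPr /= ?comb_linear0 ?comb_linear.
Qed.
HB.instance Definition _ i j l :=
  bilinear_isBilinear.Build R (Cone t i) (Cone t j) (Cone t l) _ _
    (@cone_mul_fun i j l) (@cone_mul_bilinear i j l).

Fact cone_mul_deg i j l (z : Cone t i) (w : Cone t j) :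
  l != i + j + 0 -> cone_mul_fun l z w = 0.
Proof.
move=> ijl.
have n1 : l != i + (j - 1) + 1 by rewrite addrA subrK -[i + j]addr0.
have n2 : l != i - 1 + j + 1 by rewrite addrAC subrK -[i + j]addr0.
have n3 : l != i - 1 + (j - 1) + 2.
  by rewrite (addrACA i) -(addrA (i + j)) (_ : -1 - 1 + 2 = 0 :> int).
have n1' : l - 1 != i + (j - 1) + 0 by rewrite addr0 addrA (inj_eq (addIr _)) -[i + j]addr0.
have n2' : l - 1 != i - 1 + j + 0 by rewrite addr0 addrAC (inj_eq (addIr _)) -[i + j]addr0.
have n3' : l - 1 != i - 1 + (j - 1) + 1.
  by rewrite addrA subrK addrAC (inj_eq (addIr _)) -[i + j]addr0.
by apply: pair_eq; rewrite /= !gbimap_deg // ?scaler0 ?subr0 ?addr0.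
Qed.

Definition cone_mul : gbimap 0 (Cone t) (Cone t) (Cone t) :=
  @Gbimap R 0 _ _ _ (fun i j l => @cone_mul_fun i j l) cone_mul_deg.

End ConeProduct.

Section ConeMap.
Variables (t t' : triple) (g : gmap 0 (tM t) (tM t')) (f : gmap 0 (tA t) (tA t')).

Definition cone_map_fun i j (z : Cone t i) : Cone t' j :=
  (f i j z.1, g (i - 1) (j - 1) z.2).

Fact cone_map_linear i j : linear (@cone_map_fun i j).
Proof. by move=> a z w; apply: pair_eq; rewrite /= linearP. Qed.
HB.instance Definition _ i j :=
  GRing.isLinear.Build R (Cone t i) (Cone t' j) _
    (@cone_map_fun i j) (@cone_map_linear i j).

Fact cone_map_deg i j (z : Cone t i) : j != i + 0 -> cone_map_fun j z = 0.
Proof.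
move=> ij; apply: pair_eq; rewrite /= gmap_deg //.
by move: ij; rewrite !addr0 (inj_eq (addIr _)).
Qed.

Definition cone_map : gmap 0 (Cone t) (Cone t') :=
  @Gmap R 0 _ _ (fun i j => @cone_map_fun i j) cone_map_deg.

End ConeMap.

Definition upper_triangular (t t' : triple) k (F : gmap k (Cone t) (Cone t')) : Prop :=
  forall i j (a : tA t i), (F i j ((a, 0) : Cone t i)).2 = 0.

(* [hr_homotopy] is [d, H] = 1 - I P, on components from degree i to degree i. *)
Record homotopy_retract (t t' : triple) := HomotopyRetract {
  hr_P : gmap 0 (Cone t) (Cone t');
  hr_I : gmap 0 (Cone t') (Cone t);
  hr_H : gmap 1 (Cone t) (Cone t);
  hr_P_chain : chain_map hr_P;
  hr_I_chain : chain_map hr_I;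
  hr_P_upper : upper_triangular hr_P;
  hr_I_upper : upper_triangular hr_I;
  hr_H_upper : upper_triangular hr_H;
  hr_homotopy : forall i (z : Cone t i),
    dmap hr_H i i z = z - hr_I i i (hr_P i i z) }.

Record special_morphism (t t' : triple) (S : A2_structure t) (S' : A2_structure t') :=
  SpecialMorphism {
  sm_g : gmap 0 (tM t) (tM t');
  sm_f : gmap 0 (tA t) (tA t');
  sm_mu : gbimap 1 (tA t) (tA t) (tA t');
  sm_mL : gbimap 1 (tA t) (tM t) (tM t');
  sm_mR : gbimap 1 (tM t) (tA t) (tM t');
  sm_sigma : gbimap 2 (tM t) (tM t) (tM t');
  sm_tauL : gbimap 2 (tM t) (tA t) (tA t');
  sm_tauR : gbimap 2 (tA t) (tM t) (tA t');
  sm_beta : gbimap 3 (tM t) (tM t) (tA t');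
  sm_g_chain : chain_map sm_g;
  sm_f_chain : chain_map sm_f;
  sm_fc : forall i (x : tM t i),
    sm_f i i (tc t i i x) = tc t' i i (sm_g i i x);
  sm_muP : forall i j l (a : tA t i) (b : tA t j),
    dbimap sm_mu i j l a b =
      a2_mu S' i j l (sm_f i i a) (sm_f j j b)
      - sm_f (i + j) l (a2_mu S i j (i + j) a b);
  sm_mLP : forall i j l (a : tA t i) (x : tM t j),
    dbimap sm_mL i j l a x =
      a2_mL S' i j l (sm_f i i a) (sm_g j j x)
      - sm_g (i + j) l (a2_mL S i j (i + j) a x);
  sm_mRP : forall i j l (x : tM t i) (a : tA t j),
    dbimap sm_mR i j l x a =
      a2_mR S' i j l (sm_g i i x) (sm_f j j a)
      - sm_g (i + j) l (a2_mR S i j (i + j) x a);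
  sm_sigmaP : forall i j l (x : tM t i) (y : tM t j),
    dbimap sm_sigma i j l x y =
      a2_sigma S' i j l (sm_g i i x) (sm_g j j y)
      - sm_g (i + j + 1) l (a2_sigma S i j (i + j + 1) x y)
      - sm_mR i j l x (tc t j j y) + sm_mL i j l (tc t i i x) y;
  sm_tauLP : forall i j l (x : tM t i) (a : tA t j),
    dbimap sm_tauL i j l x a =
      a2_tauL S' i j l (sm_g i i x) (sm_f j j a)
      - sm_f (i + j + 1) l (a2_tauL S i j (i + j + 1) x a)
      - sm_mu i j l (tc t i i x) a
      + tc t' (i + j + 1) l (sm_mR i j (i + j + 1) x a);
  sm_tauRP : forall i j l (a : tA t i) (x : tM t j),
    dbimap sm_tauR i j l a x =
      a2_tauR S' i j l (sm_f i i a) (sm_g j j x)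
      - sm_f (i + j + 1) l (a2_tauR S i j (i + j + 1) a x)
      - sm_mu i j l a (tc t j j x)
      + tc t' (i + j + 1) l (sm_mL i j (i + j + 1) a x);
  sm_betaP : forall i j l (x : tM t i) (y : tM t j),
    dbimap sm_beta i j l x y =
      a2_beta S' i j l (sm_g i i x) (sm_g j j y)
      - sm_f (i + j + 2) l (a2_beta S i j (i + j + 2) x y)
      + tc t' (i + j + 2) l (sm_sigma i j (i + j + 2) x y)
      - sm_tauR i j l (tc t i i x) y + sm_tauL i j l x (tc t j j y) }.

End Triples.

(* Main.v *)
(** An [A_2]-structure without the associativity axiom is the same thing as a
    bilinear chain map on the cone sending pairs of elements of the algebra
    part into the algebra part: the operations are the components of the
    product along the splitting, and their axioms are the components of the
    Leibniz rule.  For a homotopy retract, [m' = P m (I (x) I)] is such a product,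
    so it defines the transferred structure; [P] and [I] intertwine up to the
    homotopies [P m (H (x) 1 + I P (x) H)] and [- H m (I (x) I)], and
    homotopy associativity is transferred through the restriction of [H] to the
    algebra.  For a special morphism, the homotopy is assembled from the hatted
    maps by the formula that defines the product. *)
From HB Require Import structures.
Require Import Defs.
From mathcomp Require Import all_boot all_order all_algebra.
From mathcomp Require Import sesquilinear generic_quotient ring_quotient ring.

Set Implicit Arguments.
Unset Strict Implicit.
Unset Printing Implicit Defensive.

Import GRing.Theory.
Local Open Scope ring_scope.

(** * Identities in modules *)

(* The trivial square-zero extension [R (+) V] is a commutative ring in which
   [V] embeds, so [ring] decides linear identities between vectors. *)
Section TrivialExtension.
Variables (R : comNzRingType) (V : lmodType R).

Definition trivext : Type := (R * V)%type.
HB.instance Definition _ := GRing.Zmodule.on trivext.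

Definition trivext_one : trivext := (1, 0).
Definition trivext_mul (x y : trivext) : trivext :=
  (x.1 * y.1, x.1 *: y.2 + y.1 *: x.2).

Fact trivext_mulA : associative trivext_mul.
Proof.
move=> x y z; apply: Defs.pair_eq => /=; first by rewrite mulrA.
by rewrite !scalerDr !scalerA addrA (mulrC z.1) (mulrC z.1).
Qed.
Fact trivext_mulC : commutative trivext_mul.
Proof. by move=> x y; apply: Defs.pair_eq; rewrite /= 1?mulrC 1?addrC. Qed.
Fact trivext_mul1 : left_id trivext_one trivext_mul.
Proof. by move=> x; apply: Defs.pair_eq; rewrite /= ?mul1r // scale1r scaler0 addr0. Qed.
Fact trivext_mulDl : left_distributive trivext_mul +%R.
Proof.
move=> x y z; apply: Defs.pair_eq; rewrite /= ?mulrDl //.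
by rewrite scalerDl scalerDr addrACA.
Qed.
Fact trivext_1neq0 : trivext_one != 0.
Proof. by apply/eqP => -[/eqP]; rewrite oner_eq0. Qed.
HB.instance Definition _ := GRing.Zmodule_isComNzRing.Build trivext
  trivext_mulA trivext_mulC trivext_mul1 trivext_mulDl trivext_1neq0.

Definition trivext_vec (v : V) : trivext := (0, v).
Definition trivext_scal (a : R) : trivext := (a, 0).

Lemma trivext_vec_inj : injective trivext_vec. Proof. by move=> u v []. Qed.
Lemma trivext_vec0 : trivext_vec 0 = 0. Proof. by []. Qed.
Lemma trivext_vecN v : trivext_vec (- v) = - trivext_vec v.
Proof. by apply: Defs.pair_eq; rewrite //= oppr0. Qed.
Lemma trivext_vecD u v : trivext_vec (u + v) = trivext_vec u + trivext_vec v.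
Proof. by apply: Defs.pair_eq; rewrite //= addr0. Qed.
Lemma trivext_vecZ a v : trivext_vec (a *: v) = trivext_scal a * trivext_vec v.
Proof. by apply: Defs.pair_eq; rewrite /= ?mulr0 // scale0r addr0. Qed.

Lemma trivext_scal0 : trivext_scal 0 = 0. Proof. by []. Qed.
Lemma trivext_scal1 : trivext_scal 1 = 1. Proof. by []. Qed.
Lemma trivext_scalN a : trivext_scal (- a) = - trivext_scal a.
Proof. by apply: Defs.pair_eq; rewrite //= oppr0. Qed.
Lemma trivext_scalM a b : trivext_scal (a * b) = trivext_scal a * trivext_scal b.
Proof. by apply: Defs.pair_eq; rewrite //= !scaler0 addr0. Qed.
End TrivialExtension.

(** Signs are opaque atoms here: [ring] does not know that a sign squares to 1, so proofs in which a
    sign occurs squared first split on [sgn_case]. *)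
Ltac module_ring :=
  apply: trivext_vec_inj;
  rewrite ?(trivext_vecD, trivext_vecN, trivext_vecZ, trivext_vec0,
    trivext_scal0, trivext_scal1, trivext_scalN, trivext_scalM);
  ring.

(** * Graded maps *)

Section Signs.
Variable R : idomainType.
Implicit Types i j : int.

Lemma sgn_case i : sgn R i = 1 \/ sgn R i = -1.
Proof.
have h n : (-1) ^+ n = 1 :> R \/ (-1) ^+ n = -1 :> R.
  by rewrite -signr_odd; case: odd; [right; rewrite expr1|left].
rewrite /sgn; case: i => n; first exact: h.
by rewrite NegzE -exprz_inv invrN1 -exprnP; case: (h n.+1) => ->; [left|right].
Qed.

Lemma sgn_mul_self i : sgn R i * sgn R i = 1.
Proof. by case: (sgn_case i) => ->; rewrite ?mulrNN mulr1. Qed.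

Lemma sgnD i j : sgn R (i + j) = sgn R i * sgn R j.
Proof. by rewrite /sgn exprzDr // unitrN1. Qed.

Lemma sgnN i : sgn R (- i) = sgn R i.
Proof. by rewrite /sgn -exprz_inv invrN1. Qed.

Lemma sgn0 : sgn R 0 = 1. Proof. by []. Qed.
Lemma sgn1 : sgn R 1 = -1. Proof. by []. Qed.
Lemma sgn2 : sgn R 2 = 1. Proof. by rewrite (sgnD 1 1) sgn_mul_self. Qed.
Lemma sgnN1 : sgn R (-1) = -1. Proof. by rewrite /sgn exprN1 invrN1. Qed.

End Signs.

Section Components.
Variable R : idomainType.
Implicit Types (i j l p q r k : int) (U V W : int -> lmodType R).

Lemma gmap0 k V W (f : gmap k V W) i j : f i j 0 = 0.
Proof. exact: linear0. Qed.
Lemma gmapD k V W (f : gmap k V W) i j x y : f i j (x + y) = f i j x + f i j y.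
Proof. exact: linearD. Qed.
Lemma gmapN k V W (f : gmap k V W) i j x : f i j (- x) = - f i j x.
Proof. exact: linearN. Qed.
Lemma gmapZ k V W (f : gmap k V W) i j a x : f i j (a *: x) = a *: f i j x.
Proof. exact: linearZ. Qed.

Section Bilinearity.
Variables (k : int) (U V W : int -> lmodType R) (b : gbimap k U V W).

Lemma gbimap0l i j l y : b i j l 0 y = 0.
Proof. exact: linear0l. Qed.
Lemma gbimap0r i j l x : b i j l x 0 = 0.
Proof. exact: linear0r. Qed.
Lemma gbimapDl i j l x x' y : b i j l (x + x') y = b i j l x y + b i j l x' y.
Proof. exact: linearDl. Qed.
Lemma gbimapDr i j l x y y' : b i j l x (y + y') = b i j l x y + b i j l x y'.
Proof. exact: linearDr. Qed.
Lemma gbimapNl i j l x y : b i j l (- x) y = - b i j l x y.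
Proof. exact: linearNl. Qed.
Lemma gbimapNr i j l x y : b i j l x (- y) = - b i j l x y.
Proof. exact: linearNr. Qed.
Lemma gbimapZl i j l a x y : b i j l (a *: x) y = a *: b i j l x y.
Proof. exact: linearZl_LR. Qed.
Lemma gbimapZr i j l a x y : b i j l x (a *: y) = a *: b i j l x y.
Proof. exact: linearZr_LR. Qed.

End Bilinearity.

Definition gmap_linE := (gmap0, gmapD, gmapN, gmapZ, gbimap0l, gbimap0r,
  gbimapDl, gbimapDr, gbimapNl, gbimapNr, gbimapZl, gbimapZr).

(** * Transports between equal degrees, and compositions with Koszul signs *)

Section Transport.
Variable V : int -> lmodType R.

(* The identity between components whose degrees are only propositionally equal,
   such as [V i] and [V (i + 1 - 1)]. *)
Definition gid_fun i j (x : V i) : V j :=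
  if @eqP _ i j is ReflectT e then eq_rect i V x j e else 0.

Fact gid_linear i j : linear (@gid_fun i j).
Proof.
by rewrite /gid_fun => a x y; case: eqP => [e|_]; [subst j|rewrite scaler0 addr0].
Qed.
HB.instance Definition _ i j :=
  GRing.isLinear.Build R (V i) (V j) _ (@gid_fun i j) (@gid_linear i j).

Fact gid_deg i j (x : V i) : j != i + 0 -> gid_fun j x = 0.
Proof. by rewrite /gid_fun addr0 eq_sym; case: eqP. Qed.

Definition gid : gmap 0 V V := @Gmap R 0 V V (fun i j => @gid_fun i j) gid_deg.

Lemma gidE i x : gid i i x = x.
(* Equality on [int] is decidable, so a proof of [i = i] is reflexivity and the transport along it
   is trivial. *)
Proof. by rewrite /= /gid_fun; case: eqP => // e; rewrite (eq_axiomK e). Qed.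

End Transport.

Lemma gid_pre V W (f : forall i j, {linear V i -> W j}) p q l x :
  p = q -> f q l (gid V p q x) = f p l x.
Proof. by move=> <-; rewrite gidE. Qed.

(** Away from [l = p] both sides vanish: the left one by the degree of [gid], the right one by the
    degree of [f]. *)
Lemma gid_post k V W (f : gmap k V W) i p l x :
  p = i + k -> gid W p l (f i p x) = f i l x.
Proof.
move=> e; have [->|ne] := eqVneq l p; first by rewrite gidE.
by rewrite (gmap_deg (gid W)) ?addr0 // (gmap_deg f) -?e.
Qed.

Section Composition.
Variables (k k' : int) (V W X : int -> lmodType R) (h : gmap k' W X) (f : gmap k V W).

Fact gcomp_deg i j (x : V i) :
  j != i + (k + k') -> (h (i + k) j \o f i (i + k)) x = 0.
Proof. by rewrite addrA => ij; rewrite /= gmap_deg. Qed.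

(** Only the intermediate degree [i + k] can contribute, so the composite is formed through that
    degree alone. *)
Definition gcomp : gmap (k + k') V X :=
  @Gmap R (k + k') V X (fun i j => h (i + k) j \o f i (i + k)) gcomp_deg.

Lemma gcompE i p j (x : V i) : p = i + k -> gcomp i j x = h p j (f i p x).
Proof. by move=> ->. Qed.

End Composition.

Section BilinearComposition.
Variables (U U' V V' W W' : lmodType R).
Variables (h : {linear W -> W'}) (b : {bilinear U -> V -> W}).
Variables (f : {linear U' -> U}) (g : {linear V' -> V}) (a : R).

Definition bil_comp (x : U') (y : V') : W' := a *: h (b (f x) (g y)).

Fact bil_comp_bilinear : bilinear_for *:%R *:%R bil_comp.
Proof.
split=> [y|x] c u v; rewrite /bil_comp /=.
  by rewrite (linearP f) linearPl (linearP h) scalerDr !scalerA mulrC.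
by rewrite (linearP g) linearPr (linearP h) scalerDr !scalerA mulrC.
Qed.
HB.instance Definition _ :=
  bilinear_isBilinear.Build R U' V' W' _ _ bil_comp bil_comp_bilinear.
End BilinearComposition.

Section BilinearOpposite.
Variables (U V W : lmodType R) (b : {bilinear U -> V -> W}).

Definition bil_opp (x : U) (y : V) : W := - b x y.

Fact bil_opp_bilinear : bilinear_for *:%R *:%R bil_opp.
Proof.
split=> [y|x] c u v; rewrite /bil_opp /=.
  by rewrite linearPl opprD scalerN.
by rewrite linearPr opprD scalerN.
Qed.
HB.instance Definition _ :=
  bilinear_isBilinear.Build R U V W _ _ bil_opp bil_opp_bilinear.
End BilinearOpposite.

Section BilinearSum.
Variables (U V W : lmodType R) (b b' : {bilinear U -> V -> W}).

Definition bil_add (x : U) (y : V) : W := b x y + b' x y.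

Fact bil_add_bilinear : bilinear_for *:%R *:%R bil_add.
Proof.
split=> [y|x] c u v; rewrite /bil_add /=.
  by rewrite !linearPl scalerDr addrACA.
by rewrite !linearPr scalerDr addrACA.
Qed.
HB.instance Definition _ :=
  bilinear_isBilinear.Build R U V W _ _ bil_add bil_add_bilinear.
End BilinearSum.

Section KoszulComposition.
Variables (kf kg k kh K : int) (U U' V V' W W' : int -> lmodType R).
Variables (h : gmap kh W W') (b : gbimap k U V W).
Variables (f : gmap kf U' U) (g : gmap kg V' V).
Hypothesis degK : K = kf + kg + k + kh.

(* [h b (f (x) g)], with the Koszul sign of moving [g] past the first argument. *)
Definition gb_comp_fun i j l : {bilinear U' i -> V' j -> W' l} :=
  let r := i + kf + (j + kg) + k in
  bil_comp (h r l) (b (i + kf) (j + kg) r) (f i (i + kf)) (g j (j + kg)) (sgn R (kg * i)).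

Fact gb_comp_deg i j l x y : l != i + j + K -> gb_comp_fun i j l x y = 0.
Proof.
move=> ijl; rewrite /= /bil_comp gmap_deg ?scaler0 //.
by rewrite (_ : i + kf + (j + kg) + k + kh = i + j + K) // degK; ring.
Qed.

(** The total degree [K] is a parameter tied by [degK], so that a composite can be typed with the
    simplified degree, such as 0 instead of [0 + 1 + 0 + (-1)]. *)
Definition gb_comp : gbimap K U' V' W' :=
  @Gbimap R K U' V' W' gb_comp_fun gb_comp_deg.

Lemma gb_compE p q r i j l x y : p = i + kf -> q = j + kg -> r = p + q + k ->
  gb_comp i j l x y = sgn R (kg * i) *: h r l (b p q r (f i p x) (g j q y)).
Proof. by move=> -> -> ->. Qed.

End KoszulComposition.

Section Opposite.
Variables (k : int) (U V W : int -> lmodType R) (b : gbimap k U V W).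

Fact gb_opp_deg i j l x y : l != i + j + k -> bil_opp (b i j l) x y = 0.
Proof. by move=> ijl; rewrite /bil_opp gbimap_deg ?oppr0. Qed.

Definition gb_opp : gbimap k U V W :=
  @Gbimap R k U V W (fun i j l => bil_opp (b i j l)) gb_opp_deg.

End Opposite.

Section Sum.
Variables (k : int) (U V W : int -> lmodType R) (b b' : gbimap k U V W).

Fact gb_add_deg i j l x y : l != i + j + k -> bil_add (b i j l) (b' i j l) x y = 0.
Proof. by move=> ijl; rewrite /bil_add !gbimap_deg ?addr0. Qed.

Definition gb_add : gbimap k U V W :=
  @Gbimap R k U V W (fun i j l => bil_add (b i j l) (b' i j l)) gb_add_deg.

End Sum.

End Components.
Arguments gb_compE {R kf kg k kh K U U' V V' W W' h b f g degK} p q r {i j l x y}.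

(** * The Leibniz rule for commutators of compositions *)

Section Leibniz.
Variable R : idomainType.
Implicit Types (i j l p q r k : int) (C D E F : chain_complex R).

(** Intermediate degrees become parameters constrained by equations, so that a proof can choose
    expressions under which the components on both sides match syntactically. *)
Lemma dmapE p q k C D (f : gmap k C D) i l x : q = i - 1 -> p = i + k ->
  dmap f i l x = diff D p l (f i p x) - sgn R k *: f q l (diff C i q x).
Proof. by move=> -> ->. Qed.

Lemma dbimapE p q r k C D E (b : gbimap k C D E) i j l x y :
  p = i - 1 -> q = j - 1 -> r = i + j + k ->
  dbimap b i j l x y = diff E r l (b i j r x y)
    - sgn R k *: (b p j l (diff C i p x) y + sgn R i *: b i q l x (diff D j q y)).
Proof. by move=> -> -> ->. Qed.

Arguments dmapE p q {k C D f i l x}.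
Arguments dbimapE p q r {k C D E b i j l x y}.

Lemma eq_dbimap k C D E (b b' : gbimap k C D E) :
  (forall i j l x y, b i j l x y = b' i j l x y) ->
  forall i j l x y, dbimap b i j l x y = dbimap b' i j l x y.
Proof. by move=> eqb i j l x y; rewrite /dbimap !eqb. Qed.

Lemma dbimapD k C D E (b b' : gbimap k C D E) i j l x y :
  dbimap (gb_add b b') i j l x y = dbimap b i j l x y + dbimap b' i j l x y.
Proof. by rewrite /dbimap /= /bil_add !gmap_linE; module_ring. Qed.

Lemma dbimapN k C D E (b : gbimap k C D E) i j l x y :
  dbimap (gb_opp b) i j l x y = - dbimap b i j l x y.
Proof. by rewrite /dbimap /= /bil_opp !gmap_linE; module_ring. Qed.

Lemma chain_mapE C D (f : gmap 0 C D) : chain_map f ->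
  forall i p l x, p = i - 1 -> diff D i l (f i i x) = f p l (diff C i p x).
Proof.
move=> chf i p l x ep; apply/eqP; rewrite -subr_eq0.
by have := chf i l x; rewrite (dmapE i p) ?addr0 // scale1r => ->.
Qed.

Section BilinearComposition.
Variables (kf kg kh K : int) (C C' D D' E E' : chain_complex R).
Variables (h : gmap kh E E') (b : gbimap 0 C D E).
Variables (f : gmap kf C' C) (g : gmap kg D' D).
Hypothesis degK : K = kf + kg + 0 + kh.
Hypothesis chain_b : bilinear_chain_map b.

(** The commutator with the differentials is a graded derivation of composition, and the chain map
    [b] contributes nothing. The sign [sgn R p] combines passing [f] with the fact that [[d, g]] has
    one degree less than [g] when it moves past [x]. *)
Lemma dbimap_comp p q r p' q' r' i j l x y :
  p = i + kf -> q = j + kg -> r = p + q ->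
  p' = p - 1 -> q' = q - 1 -> r' = r - 1 ->
  dbimap (gb_comp h b f g degK) i j l x y = sgn R (kg * i) *: (
    dmap h r l (b p q r (f i p x) (g j q y)) + sgn R kh *: h r' l (
      b p' q r' (dmap f i p' x) (g j q y)
      + sgn R p *: b p q' r' (f i p x) (dmap g j q' y))).
Proof.
move=> ep eq er ep' eq' er'.
have db : diff E r r' (b p q r (f i p x) (g j q y)) =
    b p' q r' (diff C p p' (f i p x)) (g j q y)
    + sgn R p *: b p q' r' (f i p x) (diff D q q' (g j q y)).
  apply/eqP; rewrite -subr_eq0; have := chain_b r' (f i p x) (g j q y).
  by rewrite (dbimapE p' q' r) ?addr0 // scale1r => ->.
rewrite (dmapE (r + kh) r') //.
rewrite (dmapE p (i - 1)) // (dmapE q (j - 1)) //.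
rewrite (dbimapE (i - 1) (j - 1) (r + kh)) //; last first.
  by rewrite er ep eq degK addr0 (addrACA i) !addrA.
have ep'' : p' = i - 1 + kf by rewrite ep' ep addrAC.
have eq'' : q' = j - 1 + kg by rewrite eq' eq addrAC.
have erp : r' = p' + q by rewrite er' er ep' addrAC.
have erq : r' = p + q' by rewrite er' er eq' addrA.
rewrite (gb_compE p q r) ?addr0 // (gb_compE p' q r') ?addr0 //.
rewrite (gb_compE p q' r') ?addr0 // db.
rewrite !gmap_linE.
have -> : sgn R (kg * (i - 1)) = sgn R (kg * i) * sgn R kg.
  by rewrite mulrBr sgnD sgnN mulr1.
have -> : sgn R p = sgn R i * sgn R kf by rewrite ep sgnD.
rewrite degK !sgnD sgn0.
(* Only [sgn R kg] occurs squared: once from [K], once from moving [g] past the differential of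
   [x]. *)
case: (sgn_case R kg) => ->; module_ring.
Qed.
End BilinearComposition.
End Leibniz.
Arguments dbimap_comp {R kf kg kh K C C' D D' E E' h b f g degK} chain_b
  p q r p' q' r' {i j l x y}.
Arguments dmapE {R} p q {k C D f i l x}.
Arguments dbimapE {R} p q r {k C D E b i j l x y}.

(** * The product on homology *)

Lemma hclassP (R : idomainType) (C : chain_complex R) n a (z w : cycles C n) :
  a *: hclass z + hclass w = hclass (a *: z + w).
Proof. by rewrite hclassD hclassZ. Qed.

Section HomologyProduct.
Variables (R : idomainType) (C : chain_complex R) (m : gbimap 0 C C C).
Hypothesis chain_m : bilinear_chain_map m.

Lemma diff_product p q r i j l x y : p = i - 1 -> q = j - 1 -> r = i + j ->
  diff C r l (m i j r x y)
  = m p j l (diff C i p x) y + sgn R i *: m i q l x (diff C j q y).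
Proof.
move=> ep eq er; apply/eqP; rewrite -subr_eq0; have := chain_m l x y.
by rewrite (dbimapE p q r) ?addr0 // scale1r => ->.
Qed.

Section Degrees.
Variables i j : int.

Lemma diff_cycle n (z : cycles C n) p : diff C n p (cycle_val z) = 0.
Proof.
have [->|ne] := eqVneq p (n - 1); last by rewrite gmap_deg.
by case: z => z /= /eqP.
Qed.

Fact product_cycle_subproof (z : cycles C i) (w : cycles C j) :
  m i j (i + j) z w \in @cycle_pred R C (i + j).
Proof.
apply/eqP; rewrite (diff_product (p := i - 1) (q := j - 1)) //.
by rewrite !diff_cycle !gmap_linE scaler0 addr0.
Qed.

Definition product_cycle z w : cycles C (i + j) :=
  Cycle (product_cycle_subproof z w).

Lemma eq_hclass_product z z' w w' : hclass z = hclass z' -> hclass w = hclass w' ->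
  hclass (product_cycle z w) = hclass (product_cycle z' w').
Proof.
move=> /hclass_eq[u du] /hclass_eq[v dv]; apply/hclass_eq.
(* The difference of products is [m(z - z', w) + m(z', w - w')] with [z - z' = du] and
   [w - w' = dv]; the sign compensates for moving the differential past [z']. *)
exists (m (i + 1) j (i + j + 1) u w + sgn R i *: m i (j + 1) (i + j + 1) z' v).
rewrite !gmap_linE (diff_product (p := i) (q := j - 1)) ?addrK // 1?addrAC //.
rewrite (diff_product (p := i - 1) (q := j)) ?addrK ?addrA //.
rewrite !diff_cycle !gmap_linE du dv !gmap_linE /=.
by case: (sgn_case R i) => ->; module_ring.
Qed.

(** Computed on chosen representatives; [eq_hclass_product] makes the choice irrelevant. *)
Definition homology_product (x : homology C i) (y : homology C j) :
    homology C (i + j) :=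
  hclass (product_cycle (repr (x : Quotient.quot (boundary_pred (C := C) (n := i))))
                        (repr (y : Quotient.quot (boundary_pred (C := C) (n := j))))).

Lemma homology_productE z w :
  homology_product (hclass z) (hclass w) = hclass (product_cycle z w).
Proof. by apply: eq_hclass_product; exact: hclass_repr. Qed.

Fact homology_product_bilinear : bilinear_for *:%R *:%R homology_product.
Proof.
split=> [y|x] a u v.
  rewrite -[y]hclass_repr -[u]hclass_repr -[v]hclass_repr.
  rewrite hclassP !homology_productE /= hclassP.
  by congr hclass; apply: val_inj; rewrite /= !gmap_linE.
rewrite -[x]hclass_repr -[u]hclass_repr -[v]hclass_repr.
rewrite hclassP !homology_productE /= hclassP.
by congr hclass; apply: val_inj; rewrite /= !gmap_linE.
Qed.
HB.instance Definition _ :=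
  bilinear_isBilinear.Build R (homology C i) (homology C j) (homology C (i + j))
    _ _ homology_product homology_product_bilinear.

End Degrees.

Lemma chain_product_descends : descends_to_homology m.
Proof.
move=> i j; exists (@homology_product i j : {bilinear _ -> _ -> _}) => z z'.
by exists (product_cycle z z') => //; exact: homology_productE.
Qed.

End HomologyProduct.

(** * Bilinear maps on cones *)

Section ConeBilinear.
Variables (R : idomainType) (t t' : triple R) (k k1 k2 : int).
Variables (bAA : gbimap k (tA t) (tA t) (tA t')).
Variables (bAM : gbimap k1 (tA t) (tM t) (tA t')).
Variables (bMA : gbimap k1 (tM t) (tA t) (tA t')).
Variables (bMM : gbimap k2 (tM t) (tM t) (tA t')).
Variables (nAM : gbimap k (tA t) (tM t) (tM t')).
Variables (nMA : gbimap k (tM t) (tA t) (tM t')).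
Variables (nMM : gbimap k1 (tM t) (tM t) (tM t')).
Hypotheses (k1E : k1 = k + 1) (k2E : k2 = k + 2).

(* The sign [sgn R k] comes from moving a map of degree [k] past the shift. *)
Definition cone_bil_fun i j l (z : Cone t i) (w : Cone t j) : Cone t' l :=
  let a := z.1 in let x := z.2 in let a' := w.1 in let x' := w.2 in
  (  bAA i j l a a'
     + sgn R i *: bAM i (j - 1) l a x'
     + bMA (i - 1) j l x a'
     - sgn R i *: bMM (i - 1) (j - 1) l x x',
     sgn R k *: (sgn R i *: nAM i (j - 1) (l - 1) a x'
     + nMA (i - 1) j (l - 1) x a'
     - sgn R i *: nMM (i - 1) (j - 1) (l - 1) x x')).

Fact cone_bil_bilinear i j l : bilinear_for *:%R *:%R (@cone_bil_fun i j l).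
Proof.
by split=> [w|z] b u v; apply: Defs.pair_eq;
  rewrite /= ?linearPl ?linearPr /=; module_ring.
Qed.
HB.instance Definition _ i j l :=
  bilinear_isBilinear.Build R (Cone t i) (Cone t j) (Cone t' l) _ _
    (@cone_bil_fun i j l) (@cone_bil_bilinear i j l).

Fact cone_bil_deg i j l (z : Cone t i) (w : Cone t j) :
  l != i + j + k -> cone_bil_fun l z w = 0.
Proof.
move=> ijl; have ijl' : l - 1 != i + j + k - 1 by rewrite (inj_eq (addIr _)).
have e1 : i + (j - 1) + (k + 1) = i + j + k by ring.
have e2 : i - 1 + j + (k + 1) = i + j + k by ring.
have e3 : i - 1 + (j - 1) + (k + 2) = i + j + k by ring.
have e1' : i + (j - 1) + k = i + j + k - 1 by ring.
have e2' : i - 1 + j + k = i + j + k - 1 by ring.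
have e3' : i - 1 + (j - 1) + (k + 1) = i + j + k - 1 by ring.
apply: Defs.pair_eq; rewrite /= !gbimap_deg ?k1E ?k2E ?e1 ?e2 ?e3 ?e1' ?e2' ?e3' //.
  by rewrite scaler0 !addr0 subr0.
by rewrite !scaler0 !addr0 subr0 scaler0.
Qed.

Definition cone_bil : gbimap k (Cone t) (Cone t) (Cone t') :=
  @Gbimap R k _ _ _ (fun i j l => @cone_bil_fun i j l) cone_bil_deg.



Local Notation c := (tc t).
Local Notation c' := (tc t').

(** The terms with [c] and [c'] come from the off-diagonal parts of the two cone differentials. Each
    block is the difference of the two sides of an [A_2] axiom when [k = 0], and the commutator
    block of a special morphism when [k = 1]. *)
Lemma dbimap_cone_bil p i j l (z : Cone t i) (w : Cone t j) :
  p = i + j + k - 1 ->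
  let a := z.1 in let x := z.2 in let a' := w.1 in let x' := w.2 in
  dbimap cone_bil i j l z w =
  ( dbimap bAA i j l a a'
    + sgn R i *: (dbimap bAM i (j - 1) l a x'
        + sgn R k *: (c' p l (nAM i (j - 1) p a x')
                      - bAA i (j - 1) l a (c (j - 1) (j - 1) x')))
    + (dbimap bMA (i - 1) j l x a'
        + sgn R k *: (c' p l (nMA (i - 1) j p x a')
                      - bAA (i - 1) j l (c (i - 1) (i - 1) x) a'))
    - sgn R i *: (dbimap bMM (i - 1) (j - 1) l x x'
        + sgn R k *: (c' p l (nMM (i - 1) (j - 1) p x x')
                      - bAM (i - 1) (j - 1) l (c (i - 1) (i - 1) x) x'
                      + bMA (i - 1) (j - 1) l x (c (j - 1) (j - 1) x'))),
    - sgn R k *: (sgn R i *: dbimap nAM i (j - 1) (l - 1) a x'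
        + dbimap nMA (i - 1) j (l - 1) x a'
        - sgn R i *: (dbimap nMM (i - 1) (j - 1) (l - 1) x x'
            + sgn R k *: (nAM (i - 1) (j - 1) (l - 1) (c (i - 1) (i - 1) x) x'
                - nMA (i - 1) (j - 1) (l - 1) x (c (j - 1) (j - 1) x'))))).
Proof.
case: z w => [a x] [a' x'] -> /=.
have e1 : i + j + k = i + (j - 1) + k1 by rewrite k1E; ring.
have e2 : i + j + k = i - 1 + j + k1 by rewrite k1E; ring.
have e3 : i + j + k = i - 1 + (j - 1) + k2 by rewrite k2E; ring.
have e1' : i + j + k - 1 = i + (j - 1) + k by ring.
have e2' : i + j + k - 1 = i - 1 + j + k by ring.
have e3' : i + j + k - 1 = i - 1 + (j - 1) + k1 by rewrite k1E; ring.
have s1 : sgn R (i - 1) = - sgn R i by rewrite sgnD sgnN1 mulrN1.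
have sk1 : sgn R k1 = - sgn R k by rewrite k1E sgnD mulrN1.
have sk2 : sgn R k2 = sgn R k by rewrite k2E sgnD sgn2 mulr1.
rewrite (dbimapE (i - 1) (j - 1) (i + j + k)) //.
apply: Defs.pair_eq => /=.
  rewrite (dbimapE (i - 1) (j - 1) (i + j + k) (b := bAA)) //.
  rewrite (dbimapE (i - 1) (j - 1 - 1) (i + j + k) (b := bAM)) //.
  rewrite (dbimapE (i - 1 - 1) (j - 1) (i + j + k) (b := bMA)) //.
  rewrite (dbimapE (i - 1 - 1) (j - 1 - 1) (i + j + k) (b := bMM)) //.
  rewrite !s1 sk1 sk2.
  rewrite !gmap_linE.
    by case: (sgn_case R i) => ->; module_ring.
rewrite (dbimapE (i - 1) (j - 1 - 1) (i + j + k - 1) (b := nAM)) //.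
rewrite (dbimapE (i - 1 - 1) (j - 1) (i + j + k - 1) (b := nMA)) //.
rewrite (dbimapE (i - 1 - 1) (j - 1 - 1) (i + j + k - 1) (b := nMM)) //.
rewrite !s1 sk1.
rewrite !gmap_linE.
(* Here [sgn R k] is squared as well: it comes both from the shift in [cone_bil_fun] and from the
   commutator. *)
case: (sgn_case R i) => ->; case: (sgn_case R k) => ->; module_ring.
Qed.

End ConeBilinear.
Arguments dbimap_cone_bil {R t t' k k1 k2 bAA bAM bMA bMM nAM nMA nMM k1E k2E} p {i j l z w}.

(** * The cone product as a chain map, and its behaviour under special morphisms *)

Section ConeProductMorphism.
Variable R : idomainType.

Definition cone_mul_bil (t : triple R) (S : A2_structure t) :
    gbimap 0 (Cone t) (Cone t) (Cone t) :=
  cone_bil (a2_mu S) (a2_tauR S) (a2_tauL S) (a2_beta S)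
    (a2_mL S) (a2_mR S) (a2_sigma S) (esym (add0r 1)) (esym (add0r 2)).

Lemma cone_mulE (t : triple R) (S : A2_structure t) i j l z w :
  cone_mul S i j l z w = cone_mul_bil S i j l z w.
Proof. by apply: Defs.pair_eq; rewrite //= sgn0 scale1r. Qed.

(** The seven blocks given by [dbimap_cone_bil] at [k = 0] vanish one by one, each by the axiom of
    the corresponding operation. *)
Lemma cone_mul_chain (t : triple R) (S : A2_structure t) :
  bilinear_chain_map (cone_mul S).
Proof.
move=> i j l z w; rewrite (eq_dbimap (cone_mulE S)).
rewrite (dbimap_cone_bil (i + j - 1)) ?addr0 // sgn0 !scale1r.
rewrite a2_mu_chain a2_mL_chain a2_mR_chain a2_tauLP a2_tauRP a2_sigmaP a2_betaP.
have e1 : i + (j - 1) = i + j - 1 by ring.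
have e2 : i - 1 + j = i + j - 1 by ring.
have e3 : i - 1 + (j - 1) + 1 = i + j - 1 by ring.
rewrite e1 e2 e3.
by apply: Defs.pair_eq => /=; module_ring.
Qed.

Section SpecialMorphism.
Variables (t t' : triple R) (S : A2_structure t) (S' : A2_structure t').
Variable phi : special_morphism S S'.

Lemma sm_fcE i l x : sm_f phi i l (tc t i i x) = tc t' i l (sm_g phi i i x).
Proof.
have [->|ne] := eqVneq l i; first exact: sm_fc.
by rewrite !gmap_deg ?addr0.
Qed.

Lemma cone_map_chain : chain_map (cone_map (sm_g phi) (sm_f phi)).
Proof.
move=> i l [a x]; rewrite (dmapE i (i - 1)) ?addr0 // scale1r.
apply: Defs.pair_eq => /=.
  rewrite (chain_mapE (sm_f_chain phi) (p := i - 1)) // gmap_linE sm_fcE.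
  by module_ring.
rewrite (chain_mapE (sm_g_chain phi) (p := i - 1 - 1)) // gmap_linE.
by module_ring.
Qed.

(** In the commutator of [K] the correction terms of the axioms for the degree 2 and 3 maps cancel
    the off-diagonal terms of the cone differentials. What remains is [m' (F (x) F) - F m], hence
    the opposite of [K] is the homotopy. *)
Lemma cone_map_intertwines :
  intertwines_up_to_homotopy (cone_map (sm_g phi) (sm_f phi))
    (cone_mul S) (cone_mul S').
Proof.
pose K := cone_bil (sm_mu phi) (sm_tauR phi) (sm_tauL phi) (sm_beta phi)
  (sm_mL phi) (sm_mR phi) (sm_sigma phi) (erefl (1 + 1)) (erefl (1 + 2)).
exists (gb_opp K) => i j l [a x] [a' x'].
rewrite dbimapN (dbimap_cone_bil (i + j)) ?addrK //.
rewrite sm_muP sm_mLP sm_mRP sm_sigmaP sm_tauLP sm_tauRP sm_betaP sgn1.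
have e1 : i + (j - 1) + 1 = i + j by ring.
have e2 : i - 1 + j + 1 = i + j by ring.
have e3 : i - 1 + (j - 1) + 2 = i + j by ring.
have e1' : i + (j - 1) = i + j - 1 by ring.
have e2' : i - 1 + j = i + j - 1 by ring.
have e3' : i - 1 + (j - 1) + 1 = i + j - 1 by ring.
rewrite e1 e2 e3 e1' e2' e3'.
apply: Defs.pair_eq => /=; rewrite !gmap_linE.
  module_ring.
module_ring.
Qed.

End SpecialMorphism.
End ConeProductMorphism.

(** * Components of a cone product *)

Section ConeSplitting.
Variables (R : idomainType) (t : triple R).
Local Notation M := (tM t).
Local Notation A := (tA t).
Local Notation c := (tc t).

(** The transports [gid] turn the inclusions and projections of the splitting into graded maps; the
    shift of the module summand gives [inM] degree 1 and [prM] degree -1. *)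
Definition inA_fun i l (a : A i) : Cone t l := (gid A i l a, 0).
Definition inM_fun i l (x : M i) : Cone t l := (0, gid M i (l - 1) x).
Definition prA_fun i l (z : Cone t i) : A l := gid A i l z.1.
Definition prM_fun i l (z : Cone t i) : M l := gid M (i - 1) l z.2.

Fact inA_linear i l : linear (@inA_fun i l).
Proof. by move=> b u v; apply: Defs.pair_eq; rewrite /= ?linearP // scaler0 addr0. Qed.
Fact inM_linear i l : linear (@inM_fun i l).
Proof. by move=> b u v; apply: Defs.pair_eq; rewrite /= ?linearP // scaler0 addr0. Qed.
Fact prA_linear i l : linear (@prA_fun i l).
Proof. by move=> b u v; rewrite /prA_fun linearP. Qed.
Fact prM_linear i l : linear (@prM_fun i l).
Proof. by move=> b u v; rewrite /prM_fun linearP. Qed.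
HB.instance Definition _ i l :=
  GRing.isLinear.Build R (A i) (Cone t l) _ (@inA_fun i l) (@inA_linear i l).
HB.instance Definition _ i l :=
  GRing.isLinear.Build R (M i) (Cone t l) _ (@inM_fun i l) (@inM_linear i l).
HB.instance Definition _ i l :=
  GRing.isLinear.Build R (Cone t i) (A l) _ (@prA_fun i l) (@prA_linear i l).
HB.instance Definition _ i l :=
  GRing.isLinear.Build R (Cone t i) (M l) _ (@prM_fun i l) (@prM_linear i l).

Fact inA_deg i l (a : A i) : l != i + 0 -> inA_fun l a = 0.
Proof. by move=> il; rewrite /inA_fun gmap_deg. Qed.
Fact inM_deg i l (x : M i) : l != i + 1 -> inM_fun l x = 0.
Proof. by move=> il; rewrite /inM_fun gmap_deg // addr0 subr_eq. Qed.
Fact prA_deg i l (z : Cone t i) : l != i + 0 -> prA_fun l z = 0.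
Proof. by move=> il; rewrite /prA_fun gmap_deg. Qed.
Fact prM_deg i l (z : Cone t i) : l != i + (-1) -> prM_fun l z = 0.
Proof. by move=> il; rewrite /prM_fun gmap_deg // addr0. Qed.

Definition inA : gmap 0 A (Cone t) := @Gmap R 0 _ _ (fun i l => @inA_fun i l) inA_deg.
Definition inM : gmap 1 M (Cone t) := @Gmap R 1 _ _ (fun i l => @inM_fun i l) inM_deg.
Definition prA : gmap 0 (Cone t) A := @Gmap R 0 _ _ (fun i l => @prA_fun i l) prA_deg.
Definition prM : gmap (-1) (Cone t) M :=
  @Gmap R (-1) _ _ (fun i l => @prM_fun i l) prM_deg.

Lemma inAE i a : inA i i a = (a, 0) :> Cone t i.
Proof. by rewrite /= /inA_fun gidE. Qed.
Lemma inME i x : inM (i - 1) i x = (0, x) :> Cone t i.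
Proof. by rewrite /= /inM_fun gidE. Qed.
Lemma prAE i z : prA i i z = z.1.
Proof. exact: gidE. Qed.
Lemma prME i z : prM i (i - 1) z = z.2.
Proof. exact: gidE. Qed.

(** The algebra is a subcomplex of the cone and the shifted module is the quotient, so [inA] and
    [prM] have zero commutator. The failure of [inM] and [prA] to be chain maps is exactly [c], up
    to sign. *)
Lemma dmap_inA i l a : dmap inA i l a = 0.
Proof.
rewrite (dmapE i (i - 1)) ?addr0 // scale1r inAE.
apply: Defs.pair_eq => /=; last by rewrite gmap_linE !oppr0 addr0.
by rewrite gmap_linE addr0 gid_post // subrr.
Qed.

Lemma dmap_inM i l x : dmap inM i l x = inA i l (c i i x).
Proof.
rewrite (dmapE (i + 1) (i - 1)) // sgn1.
apply: Defs.pair_eq => /=.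
  by rewrite !gmap_linE scaler0 oppr0 addr0 add0r gid_pre ?addrK // gid_post ?addr0.
by rewrite gid_pre ?addrK // gid_post //; module_ring.
Qed.

Lemma dmap_prA i l z : dmap prA i l z = - c (i - 1) l z.2.
Proof.
rewrite (dmapE i (i - 1)) ?addr0 // scale1r prAE.
have -> : prA (i - 1) l (diff (Cone t) i (i - 1) z) =
    gid A (i - 1) l (diff A i (i - 1) z.1 + c (i - 1) (i - 1) z.2) by [].
by rewrite gmap_linE !gid_post ?addr0 //; module_ring.
Qed.

Lemma dmap_prM i l z : dmap prM i l z = 0.
Proof.
rewrite (dmapE (i - 1) (i - 1)) // sgnN1 prME.
have -> : prM (i - 1) l (diff (Cone t) i (i - 1) z) =
    gid M (i - 1 - 1) l (- diff M (i - 1) (i - 1 - 1) z.2) by [].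
by rewrite gmap_linE gid_post //; module_ring.
Qed.

End ConeSplitting.

(** * Recovering the operations and their axioms from a product on the cone *)

Section ConeProductComponents.
Variables (R : idomainType) (t : triple R).
Local Notation A := (tA t).
Local Notation M := (tM t).
Local Notation c := (tc t).
Local Notation inA := (inA t).
Local Notation inM := (inM t).
Local Notation prA := (prA t).
Local Notation prM := (prM t).

Variable m : gbimap 0 (Cone t) (Cone t) (Cone t).
Hypothesis chain_m : bilinear_chain_map m.
Hypothesis upper_m : forall i j l (a : A i) (b : A j),
  (m i j l (inA i i a) (inA j j b)).2 = 0.

Fact degL : 0 = 0 + 1 + 0 + (-1) :> int. Proof. by []. Qed.
Fact degR : 0 = 1 + 0 + 0 + (-1) :> int. Proof. by []. Qed.

(** These are the matrix entries of [m]; the Koszul signs built into [gb_comp] are the ones that the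
    formula of the cone product undoes. *)
Definition comp_mu : gbimap 0 A A A := gb_comp prA m inA inA (erefl _).
Definition comp_mL : gbimap 0 A M M := gb_comp prM m inA inM degL.
Definition comp_mR : gbimap 0 M A M := gb_comp prM m inM inA degR.
Definition comp_tauL : gbimap 1 M A A := gb_comp prA m inM inA (erefl _).
Definition comp_tauR : gbimap 1 A M A := gb_comp prA m inA inM (erefl _).
Definition comp_sigma : gbimap 1 M M M := gb_comp prM m inM inM (erefl _).
Definition comp_beta : gbimap 2 M M A := gb_comp prA m inM inM (erefl _).

Lemma prM_upper i j r l (a : A i) (b : A j) :
  prM r l (m i j r (inA i i a) (inA j j b)) = 0.
Proof. by rewrite -[LHS]/(gid M (r - 1) l (m i j r _ _).2) upper_m gmap0. Qed.

Lemma tc_prM r p l z : p = r - 1 -> c p l (prM r p z) = c (r - 1) l z.2.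
Proof. by move=> e; rewrite -[prM _ _ _]/(gid M (r - 1) p z.2) gid_pre. Qed.

(** By [dbimap_comp], only commutators of inclusions and projections survive. The projection [prA]
    contributes [c] of the module component, which is zero by [upper_m]. *)
Lemma comp_mu_chain : bilinear_chain_map comp_mu.
Proof.
move=> i j l a b.
rewrite (dbimap_comp chain_m i j (i + j) (i - 1) (j - 1) (i + j - 1)) ?addr0 //.
by rewrite dmap_prA upper_m !dmap_inA !gmap_linE; module_ring.
Qed.

(** The commutator of [inM] replaces the module argument by its image under [c]; the product then
    has two algebra arguments and [prM] kills it. *)
Lemma comp_mL_chain : bilinear_chain_map comp_mL.
Proof.
move=> i j l a x.
rewrite (dbimap_comp chain_m i (j + 1) (i + (j + 1)) (i - 1) j (i + j))
  ?addr0 ?addrK //; last by ring.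
by rewrite dmap_prM dmap_inA dmap_inM !gmap_linE prM_upper; module_ring.
Qed.

Lemma comp_mR_chain : bilinear_chain_map comp_mR.
Proof.
move=> i j l x a.
rewrite (dbimap_comp chain_m (i + 1) j (i + 1 + j) i (j - 1) (i + j))
  ?addr0 ?addrK //; last by ring.
by rewrite dmap_prM dmap_inA dmap_inM !gmap_linE prM_upper; module_ring.
Qed.

Lemma comp_tauLP i j l (x : M i) (a : A j) :
  dbimap comp_tauL i j l x a =
    comp_mu i j l (c i i x) a - c (i + j) l (comp_mR i j (i + j) x a).
Proof.
rewrite (dbimap_comp chain_m (i + 1) j (i + 1 + j) i (j - 1) (i + j))
  ?addr0 ?addrK //; last by ring.
rewrite (gb_compE i j (i + j)) ?addr0 // (gb_compE (i + 1) j (i + 1 + j)) ?addr0 //.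
rewrite dmap_prA dmap_inA dmap_inM !gmap_linE tc_prM; last by ring.
by rewrite !mul0r sgn0; module_ring.
Qed.

Lemma comp_tauRP i j l (a : A i) (x : M j) :
  dbimap comp_tauR i j l a x =
    comp_mu i j l a (c j j x) - c (i + j) l (comp_mL i j (i + j) a x).
Proof.
rewrite (dbimap_comp chain_m i (j + 1) (i + (j + 1)) (i - 1) j (i + j))
  ?addr0 ?addrK //; last by ring.
rewrite (gb_compE i j (i + j)) ?addr0 // (gb_compE i (j + 1) (i + (j + 1))) ?addr0 //.
rewrite dmap_prA dmap_inA dmap_inM !gmap_linE tc_prM; last by ring.
by rewrite mul0r mul1r sgn0; case: (sgn_case R i) => ->; module_ring.
Qed.

Lemma comp_sigmaP i j l (x : M i) (y : M j) :
  dbimap comp_sigma i j l x y =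
    comp_mR i j l x (c j j y) - comp_mL i j l (c i i x) y.
Proof.
rewrite (dbimap_comp chain_m (i + 1) (j + 1) (i + 1 + (j + 1)) i j (i + j + 1))
  ?addrK //; last by ring.
rewrite (gb_compE (i + 1) j (i + j + 1)) ?addr0 //; last by ring.
rewrite (gb_compE i (j + 1) (i + j + 1)) ?addr0 //; last by ring.
rewrite dmap_prM !dmap_inM !gmap_linE mul0r mul1r sgn0 sgnN1 sgnD sgn1.
by case: (sgn_case R i) => ->; module_ring.
Qed.

(** The three terms come, in order, from the commutators of [prA], of the first [inM] and of the
    second [inM]. *)
Lemma comp_betaP i j l (x : M i) (y : M j) :
  dbimap comp_beta i j l x y =
    - c (i + j + 1) l (comp_sigma i j (i + j + 1) x y)
    + comp_tauR i j l (c i i x) y - comp_tauL i j l x (c j j y).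
Proof.
rewrite (dbimap_comp chain_m (i + 1) (j + 1) (i + 1 + (j + 1)) i j (i + j + 1))
  ?addrK //; last by ring.
rewrite (gb_compE (i + 1) (j + 1) (i + 1 + (j + 1))) ?addr0 //.
rewrite (gb_compE i (j + 1) (i + j + 1)) ?addr0 //; last by ring.
rewrite (gb_compE (i + 1) j (i + j + 1)) ?addr0 //; last by ring.
rewrite dmap_prA !dmap_inM !gmap_linE tc_prM; last by ring.
rewrite mul0r mul1r sgn0 sgnD sgn1.
by case: (sgn_case R i) => ->; module_ring.
Qed.

Hypothesis assoc_mu : homotopy_associative comp_mu.

(** Homotopy associativity is not a component of the Leibniz rule, so it enters as a separate
    hypothesis. *)
Definition comp_A2_structure : A2_structure t :=
  A2Structure assoc_mu comp_mu_chain comp_mL_chain comp_mR_chain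
    comp_tauLP comp_tauRP comp_sigmaP comp_betaP.

End ConeProductComponents.

(** A product is the sum of its matrix entries; the one entry absent from the formula, from two
    algebra elements to the module, is zero by [upper_m]. *)
Lemma cone_mul_comp (R : idomainType) (t : triple R)
    (m : gbimap 0 (Cone t) (Cone t) (Cone t)) (chain_m : bilinear_chain_map m)
    (upper_m : forall i j l (a : tA t i) (b : tA t j),
       (m i j l (inA t i i a) (inA t j j b)).2 = 0)
    (assoc_m : homotopy_associative (comp_mu m)) i j l z w :
  cone_mul (comp_A2_structure chain_m upper_m assoc_m) i j l z w = m i j l z w.
Proof.
have [->|ne] := eqVneq l (i + j); last by rewrite !gbimap_deg ?addr0.
case: z w => [a x] [a' x'].
have dz (k : int) (b : tA t k) (y : tM t (k - 1)) :
    (b, y) = inA t k k b + inM t (k - 1) k y :> Cone t k.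
  by rewrite inAE inME; apply: Defs.pair_eq; rewrite /= ?addr0 ?add0r.
rewrite [in RHS](dz _ a x) [in RHS](dz _ a' x') !(gbimapDl m) !(gbimapDr m).
(* The first argument of [sigma] and [beta] has degree [i - 1]; its Koszul sign accounts for the
   minus in front of these terms. *)
have sgn_pred : sgn R (i - 1) = - sgn R i by rewrite sgnD sgnN1 mulrN1.
apply: Defs.pair_eq.
  rewrite -[LHS]/(comp_mu m i j (i + j) a a'
    + sgn R i *: comp_tauR m i (j - 1) (i + j) a x'
    + comp_tauL m (i - 1) j (i + j) x a'
    - sgn R i *: comp_beta m (i - 1) (j - 1) (i + j) x x').
  rewrite !(gb_compE i j (i + j)) ?addr0 ?subrK //.
  rewrite !prAE !mul0r !mul1r sgn0 sgn_pred.
  by case: (sgn_case R i) => ->; module_ring.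
rewrite -[LHS]/(sgn R i *: comp_mL m i (j - 1) (i + j - 1) a x'
  + comp_mR m (i - 1) j (i + j - 1) x a'
  - sgn R i *: comp_sigma m (i - 1) (j - 1) (i + j - 1) x x').
rewrite !(gb_compE i j (i + j)) ?addr0 ?subrK //.
rewrite !prME !mul0r !mul1r sgn0 sgn_pred /= upper_m.
by case: (sgn_case R i) => ->; module_ring.
Qed.

(** * Transfer along a homotopy retract *)

Section AssociativityTransfer.
Variables (R : idomainType) (C D : chain_complex R).
Variables (mu : gbimap 0 C C C) (mu' : gbimap 0 D D D).
Variables (p : gmap 0 C D) (q : gmap 0 D C) (eta : gmap 1 C C).
Hypotheses (chain_mu : bilinear_chain_map mu) (chain_p : chain_map p)
  (chain_q : chain_map q).
Hypothesis dmap_eta : forall i x, dmap eta i i x = x - q i i (p i i x).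
Hypothesis mu'E : forall i j l x y,
  mu' i j l x y = p (i + j) l (mu i j (i + j) (q i i x) (q j j y)).

(* [dmap_eta] rewrites the inner [q p] in the transported associator as
   [1 - [d, eta]]. *)
Definition transfer_homotopy_fun (h : gtrimap 1 C C C C) i j l n
    (x : D i) (y : D j) (z : D l) : D n :=
  let r := i + j + l + 1 in
  p r n (h i j l r (q i i x) (q j j y) (q l l z)
    - mu (i + j + 1) l r
        (eta (i + j) (i + j + 1) (mu i j (i + j) (q i i x) (q j j y))) (q l l z)
    + sgn R i *: mu i (j + l + 1) r (q i i x)
        (eta (j + l) (j + l + 1) (mu j l (j + l) (q j j y) (q l l z)))).

Fact transfer_homotopy1 h i j l n y z :
  linear (fun x => @transfer_homotopy_fun h i j l n x y z).
Proof.
move=> a u v; rewrite /transfer_homotopy_fun !gmap_linE.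
by rewrite (trilinear1 (h i j l _)) !gmap_linE; module_ring.
Qed.
Fact transfer_homotopy2 h i j l n x z :
  linear (fun y => @transfer_homotopy_fun h i j l n x y z).
Proof.
move=> a u v; rewrite /transfer_homotopy_fun !gmap_linE.
by rewrite (trilinear2 (h i j l _)) !gmap_linE; module_ring.
Qed.
Fact transfer_homotopy3 h i j l n x y :
  linear (fun z => @transfer_homotopy_fun h i j l n x y z).
Proof.
move=> a u v; rewrite /transfer_homotopy_fun !gmap_linE.
by rewrite (trilinear3 (h i j l _)) !gmap_linE; module_ring.
Qed.

Fact transfer_homotopy_deg h i j l n x y z :
  n != i + j + l + 1 -> @transfer_homotopy_fun h i j l n x y z = 0.
Proof. by move=> ne; rewrite /transfer_homotopy_fun gmap_deg ?addr0. Qed.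

Definition transfer_homotopy h : gtrimap 1 D D D D :=
  @Gtrimap R 1 D D D D (fun i j l n =>
    Trilinear (@transfer_homotopy1 h i j l n) (@transfer_homotopy2 h i j l n)
              (@transfer_homotopy3 h i j l n)) (transfer_homotopy_deg h).

Lemma transfer_homotopyE h r s s1 u u1 i j l n x y z :
  r = i + j + l + 1 -> s = i + j -> s1 = i + j + 1 -> u = j + l -> u1 = j + l + 1 ->
  transfer_homotopy h i j l n x y z =
  p r n (h i j l r (q i i x) (q j j y) (q l l z)
    - mu s1 l r (eta s s1 (mu i j s (q i i x) (q j j y))) (q l l z)
    + sgn R i *: mu i u1 r (q i i x) (eta u u1 (mu j l u (q j j y) (q l l z)))).
Proof. by move=> -> -> -> -> ->. Qed.

(** The relation [[d, eta] = 1 - q p] at a product, solved for the term [d eta] and with the other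
    differential moved inside by the Leibniz rule. *)
Lemma diff_eta_product i j s s1 x y : s = i + j -> s1 = i + j + 1 ->
  diff C s1 s (eta s s1 (mu i j s x y)) =
  mu i j s x y - q s s (p s s (mu i j s x y))
  - eta (s - 1) s (mu (i - 1) j (s - 1) (diff C i (i - 1) x) y
                   + sgn R i *: mu i (j - 1) (s - 1) x (diff C j (j - 1) y)).
Proof.
move=> es es1; have := dmap_eta (mu i j s x y).
rewrite (dmapE s1 (s - 1)) ?es1 ?es // => <-.
rewrite (diff_product chain_mu (p := i - 1) (q := j - 1)) //.
by rewrite !gmap_linE; module_ring.
Qed.

(** With [a], [b], [c] the images under [q], the associator of [mu'] is [p] of the associator of
    [mu] minus [mu([d, eta] mu(a, b), c)] plus [mu(a, [d, eta] mu(b, c))]. These are bounded by the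
    three terms of the homotopy. *)
Lemma homotopy_associative_transfer :
  homotopy_associative mu -> homotopy_associative mu'.
Proof.
case=> h dh; exists (transfer_homotopy h) => i j l n x y z.
rewrite /dtrimap.
have er : i + j + l = i + j + l + 1 - 1 by ring.
have q_diff k (v : D k) : q (k - 1) (k - 1) (diff D k (k - 1) v) = diff C k (k - 1) (q k k v).
  by rewrite (chain_mapE chain_q (p := k - 1)).
rewrite (@transfer_homotopyE h (i + j + l + 1) (i + j) (i + j + 1) (j + l) (j + l + 1)) //.
(* These are the terms in which [x], [y] or [z] is differentiated; the indices are chosen so that
   [p] is always applied in degree [i + j + l]. *)
rewrite (@transfer_homotopyE h (i + j + l) (i + j - 1) (i + j) (j + l) (j + l + 1)); try ring.
rewrite (@transfer_homotopyE h (i + j + l) (i + j - 1) (i + j) (j + l - 1) (j + l)); try ring.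
rewrite (@transfer_homotopyE h (i + j + l) (i + j) (i + j + 1) (j + l - 1) (j + l)); try ring.
rewrite !q_diff (chain_mapE chain_p (p := i + j + l)) //.
move: (dh i j l (i + j + l) (q i i x) (q j j y) (q l l z)).
rewrite /dtrimap !mu'E.
set a := q i i x; set b := q j j y; set c := q l l z => dhabc.
have dh' : diff C (i + j + l + 1) (i + j + l) (h i j l (i + j + l + 1) a b c) =
    mu (i + j) l (i + j + l) (mu i j (i + j) a b) c
    - mu i (j + l) (i + j + l) a (mu j l (j + l) b c)
    - (h (i - 1) j l (i + j + l) (diff C i (i - 1) a) b c
       + sgn R i *: h i (j - 1) l (i + j + l) a (diff C j (j - 1) b) c
       + sgn R (i + j) *: h i j (l - 1) (i + j + l) a b (diff C l (l - 1) c)).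
  by rewrite -dhabc sgn1; module_ring.
rewrite !gmap_linE dh' (diff_product chain_mu (p := i + j) (q := l - 1)); try ring.
rewrite (diff_product chain_mu (p := i - 1) (q := j + l)); try ring.
rewrite !diff_eta_product // (addrA i j l) !gmap_linE.
rewrite sgn1 !sgnD sgnN1 sgn1.
by case: (sgn_case R i) => ->; case: (sgn_case R j) => ->; module_ring.
Qed.

End AssociativityTransfer.

(** * Chain maps, and restriction of upper triangular maps to the algebra summand *)

Section ChainMaps.
Variables (R : idomainType).
Implicit Types C D E : chain_complex R.

Lemma gid_chain C : chain_map (gid C).
Proof.
move=> i l x; rewrite (dmapE i (i - 1)) ?addr0 // scale1r gidE gid_post //.
by rewrite subrr.
Qed.

Lemma gcomp_chain C D E (h : gmap 0 D E) (f : gmap 0 C D) :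
  chain_map h -> chain_map f -> chain_map (gcomp h f).
Proof.
move=> chh chf i l x.
rewrite (dmapE (k := 0 + 0) i (i - 1)) ?addr0 // scale1r !(gcompE _ _ _ _ (esym (addr0 _))).
rewrite (chain_mapE chh (p := i - 1)) // (chain_mapE chf (p := i - 1)) //.
by rewrite subrr.
Qed.

Lemma dmap_deg k C D (f : gmap k C D) i l x : l != i + k - 1 -> dmap f i l x = 0.
Proof.
move=> ne; rewrite /dmap (gmap_deg (diff D)) //.
by rewrite (gmap_deg f) ?scaler0 ?subrr // addrAC.
Qed.

End ChainMaps.

Section AlgebraPart.
Variables (R : idomainType) (t t' : triple R) (k : int).
Variable F : gmap k (Cone t) (Cone t').
Hypothesis upper_F : upper_triangular F.

Definition partA_fun i l (a : tA t i) : tA t' l := (F i l ((a, 0) : Cone t i)).1.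

Fact partA_linear i l : linear (@partA_fun i l).
Proof.
move=> b u v; rewrite /partA_fun.
have -> : (b *: u + v, 0) = b *: (u, 0) + (v, 0) :> Cone t i.
  by apply: Defs.pair_eq; rewrite //= scaler0 addr0.
by rewrite linearP.
Qed.
HB.instance Definition _ i l :=
  GRing.isLinear.Build R (tA t i) (tA t' l) _ (@partA_fun i l) (@partA_linear i l).

Fact partA_deg i l (a : tA t i) : l != i + k -> partA_fun l a = 0.
Proof. by move=> ne; rewrite /partA_fun gmap_deg. Qed.

Definition partA : gmap k (tA t) (tA t') :=
  @Gmap R k _ _ (fun i l => @partA_fun i l) partA_deg.

Lemma partAE i l (a : tA t i) :
  F i l ((a, 0) : Cone t i) = (partA i l a, 0) :> Cone t' l.
Proof. by apply: Defs.pair_eq; rewrite //= upper_F. Qed.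

(** The algebra is a subcomplex preserved by [F], so restricting to it commutes with forming the
    commutator. *)
Lemma dmap_partA i l (a : tA t i) :
  dmap partA i l a = (dmap F i l ((a, 0) : Cone t i)).1.
Proof.
have da : diff (Cone t) i (i - 1) (a, 0) = (diff (tA t) i (i - 1) a, 0).
  by apply: Defs.pair_eq; rewrite /= gmap_linE ?addr0 ?oppr0.
rewrite /dmap da partAE /= /cone_diff_fun /= gmap0 addr0.
by [].
Qed.

End AlgebraPart.

(** * The transferred structure and its intertwining homotopies *)

Section Retract.
Variables (R : idomainType) (t t' : triple R) (S : A2_structure t).
Variable hr : homotopy_retract t t'.
Local Notation P := (hr_P hr).
Local Notation I := (hr_I hr).
Local Notation H := (hr_H hr).
Local Notation m := (cone_mul S).

Definition retract_mul : gbimap 0 (Cone t') (Cone t') (Cone t') :=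
  gb_comp P m I I (erefl _).

Lemma retract_mulE i j r l z w : r = i + j ->
  retract_mul i j l z w = P r l (m i j r (I i i z) (I j j w)).
Proof. by move=> e; rewrite (gb_compE i j r) ?addr0 // mul0r sgn0 scale1r. Qed.

Lemma retract_mul_chain : bilinear_chain_map retract_mul.
Proof.
move=> i j l z w.
rewrite (dbimap_comp (cone_mul_chain S) i j (i + j) (i - 1) (j - 1) (i + j - 1))
  ?addr0 //.
by rewrite hr_P_chain !hr_I_chain !gmap_linE; module_ring.
Qed.

Lemma cone_mul_upper i j l (a : tA t i) (b : tA t j) :
  m i j l ((a, 0) : Cone t i) ((b, 0) : Cone t j) = (a2_mu S i j l a b, 0).
Proof. by apply: Defs.pair_eq; rewrite /= !gmap_linE; module_ring. Qed.

Lemma retract_mul_inA i j r l (a : tA t' i) (b : tA t' j) : r = i + j ->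
  retract_mul i j l (inA t' i i a) (inA t' j j b) =
  (partA P r l (a2_mu S i j r (partA I i i a) (partA I j j b)), 0).
Proof.
move=> e; rewrite (retract_mulE _ _ _ e) !inAE.
rewrite !(partAE (hr_I_upper hr)) cone_mul_upper.
exact: (partAE (hr_P_upper hr)).
Qed.

Lemma retract_mul_upper i j l (a : tA t' i) (b : tA t' j) :
  (retract_mul i j l (inA t' i i a) (inA t' j j b)).2 = 0.
Proof. by rewrite (retract_mul_inA _ _ _ (erefl _)). Qed.

(** Upper triangularity of [P] and [I] keeps the computation inside the algebras, which is the form
    that [homotopy_associative_transfer] requires. *)
Lemma retract_muE i j l (a : tA t' i) (b : tA t' j) :
  comp_mu retract_mul i j l a b =
  partA P (i + j) l (a2_mu S i j (i + j) (partA I i i a) (partA I j j b)).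
Proof.
have [->|ne] := eqVneq l (i + j); last first.
  by rewrite gbimap_deg ?addr0 // gmap_deg ?addr0.
rewrite (gb_compE i j (i + j)) ?addr0 // mul0r sgn0 scale1r prAE.
by rewrite (retract_mul_inA _ _ _ (erefl _)).
Qed.

Lemma retract_mu_assoc : homotopy_associative (comp_mu retract_mul).
Proof.
apply: (homotopy_associative_transfer (p := partA P) (q := partA I)
  (eta := partA H) (a2_mu_chain S) _ _ _ retract_muE (a2_mu_assoc S)).
- by move=> i l a; rewrite (dmap_partA (hr_P_upper hr)) hr_P_chain.
- by move=> i l a; rewrite (dmap_partA (hr_I_upper hr)) hr_I_chain.
move=> i a; rewrite (dmap_partA (hr_H_upper hr)) hr_homotopy.
by rewrite (partAE (hr_P_upper hr)).
Qed.

Definition retract_A2_structure : A2_structure t' :=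
  comp_A2_structure retract_mul_chain retract_mul_upper retract_mu_assoc.

Lemma retract_P_intertwines :
  intertwines_up_to_homotopy P m (cone_mul retract_A2_structure).
Proof.
pose IP : gmap 0 (Cone t) (Cone t) := gcomp I P.
have chain_IP : chain_map IP := gcomp_chain (hr_I_chain hr) (hr_P_chain hr).
have IPE i z : IP i i z = I i i (P i i z) by rewrite (gcompE _ _ _ _ (esym (addr0 _))).
(* Telescoping: [m - m (IP (x) IP) = m ((1 - IP) (x) 1) + m (IP (x) (1 - IP))], with one homotopy
   for each summand. *)
exists (gb_add (gb_comp P m H (gid (Cone t)) (erefl _))
               (gb_comp P m IP H (erefl _))) => i j l z w.
rewrite dbimapD cone_mul_comp (retract_mulE _ _ _ (erefl _)).
rewrite (dbimap_comp (cone_mul_chain S) (i + 1) j (i + 1 + j) i (j - 1) (i + j))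
  ?addr0 ?addrK //; last by ring.
rewrite (dbimap_comp (cone_mul_chain S) i (j + 1) (i + (j + 1)) (i - 1) j (i + j))
  ?addr0 ?addrK //; last by ring.
rewrite !hr_P_chain gid_chain chain_IP !hr_homotopy !IPE gidE !gmap_linE.
by rewrite mul0r mul1r sgn0; case: (sgn_case R i) => ->; module_ring.
Qed.

Lemma retract_I_intertwines :
  intertwines_up_to_homotopy I (cone_mul retract_A2_structure) m.
Proof.
(* The defect is [I P m (I (x) I) - m (I (x) I) = -(1 - I P) m (I (x) I)], whence the opposite. *)
exists (gb_opp (gb_comp H m I I (erefl _))) => i j l z w.
rewrite dbimapN cone_mul_comp (retract_mulE _ _ _ (erefl _)).
rewrite (dbimap_comp (cone_mul_chain S) i j (i + j) (i - 1) (j - 1) (i + j - 1))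
  ?addr0 //.
rewrite !hr_I_chain !gmap_linE mul0r sgn0.
(* The relation for [H] is stated only from a degree to itself; in other target degrees all terms
   vanish. *)
have [->|ne] := eqVneq l (i + j); first by rewrite hr_homotopy; module_ring.
rewrite (dmap_deg H) ?addrK // (gmap_deg I) ?addr0 // (gbimap_deg m) ?addr0 //.
by module_ring.
Qed.

End Retract.

Theorem theoremA (R : idomainType) (pidR : principal_ideal_domain R)
    (t : triple R) (S : A2_structure t) :
  [/\ bilinear_chain_map (cone_mul S),
      descends_to_homology (cone_mul S),
      (forall (t' : triple R) (hr : homotopy_retract t t'),
         exists S' : A2_structure t',
           intertwines_up_to_homotopy (hr_P hr) (cone_mul S) (cone_mul S') /\
           intertwines_up_to_homotopy (hr_I hr) (cone_mul S') (cone_mul S))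
    & (forall (t' : triple R) (S' : A2_structure t') (phi : special_morphism S S'),
         chain_map (cone_map (sm_g phi) (sm_f phi)) /\
         intertwines_up_to_homotopy (cone_map (sm_g phi) (sm_f phi))
           (cone_mul S) (cone_mul S'))].
Proof.
split.
- exact: cone_mul_chain.
- exact/chain_product_descends/cone_mul_chain.
- move=> t' hr; exists (retract_A2_structure S hr).
  by split; [exact: retract_P_intertwines | exact: retract_I_intertwines].
move=> t' S' phi.
by split; [exact: cone_map_chain | exact: cone_map_intertwines].
Qed.
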